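(* Let $d,n\in\mathbb{N}$ with $d,n\ge 1$, let $R>0$, and let $X:=\{x\in\mathbb{R}^d : \|x\|\le R\}$. Let $\Sigma\in\mathbb{R}^{d\times d}$ be a symmetric positive definite matrix, and let $F(x,\xi)=\frac12\|x\|^2-\xi^Tx$. Consider the statistical decision problem in which the state of nature is $\mu\in\mathbb{R}^d$, the data are $n$ i.i.d. samples $\xi^1,\ldots,\xi^n\sim N(\mu,\Sigma)$, the action set is $X$, and the loss is $$\mathcal{L}(\mu,x) = \Big(\tfrac12\|x\|^2-\mu^Tx\Big) - \min_{z\in X}\Big(\tfrac12\|z\|^2-\mu^Tz\Big).$$ Let $\delta^n_{SA}$ be the sample average decision rule given by $$\delta^n_{SA}(\xi^1,\ldots,\xi^n)\in\arg\min\left\{\tfrac12\|x\|^2-\overline{\xi}^Tx : x\in X\right\},\qquad \overline{\xi}:=\frac1n\sum_{i=1}^n\xi^i.$$ Then $\delta^n_{SA}$ is admissible within $\Delta^n$.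
   Context: $\|\cdot\|$ is the Euclidean norm. Underlying stochastic optimization problem: $\min_{x\in X}\{f_\mu(x) := \mathbb{E}_{\xi\sim N(\mu,\Sigma)}[F(x,\xi)]\}$, where $N(\mu,\Sigma)$ is the Gaussian distribution on $\mathbb{R}^d$ with mean $\mu$ and covariance $\Sigma$. The matrix $\Sigma$ is fixed and the states of nature are parametrized by $\mu\in\mathbb{R}^d$. The loss of an action $x\in X$ in state $\mu$ is $\mathcal{L}(\mu,x) := f_\mu(x) - \min_{z\in X} f_\mu(z)$, which for $F(x,\xi)=\frac12\|x\|^2-\xi^Tx$ is the expression in the claim. A decision rule is a (measurable) map $\delta : (\mathbb{R}^d)^n \to X$. $\Delta^n$ denotes the set of all decision rules $\delta:(\mathbb{R}^d)^n\to X$ such that the expectation $\mathbb{E}_{\xi^1,\ldots,\xi^n}[\delta(\xi^1,\ldots,\xi^n)]$ exists, where $\xi^1,\dots,\xi^n$ are i.i.d. $N(\mu,\Sigma)$. The risk of $\delta$ is $\mathcal{R}(\mu,\delta) := \mathbb{E}_{\xi^1,\ldots,\xi^n\ \text{i.i.d.}\ \sim N(\mu,\Sigma)}[\mathcal{L}(\mu,\delta(\xi^1,\ldots,\xi^n))]$. A decision rule $\delta'$ dominates $\delta$ if $\mathcal{R}(\mu,\delta')\le\mathcal{R}(\mu,\delta)$ for all $\mu\in\mathbb{R}^d$ and $\mathcal{R}(\hat\mu,\delta')<\mathcal{R}(\hat\mu,\delta)$ for some $\hat\mu\in\mathbb{R}^d$. A rule $\delta$ is admissible within $\Delta^n$ if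 no $\delta'\in\Delta^n$ dominates $\delta$. *)

(* Defs.v *)
From HB Require Import structures.
From mathcomp Require Import all_boot all_order all_algebra.
From mathcomp Require Import all_classical all_reals all_analysis.
From mathcomp Require Import measurable_realfun.

Set Implicit Arguments.
Unset Strict Implicit.
Unset Printing Implicit Defensive.

Import Order.TTheory GRing.Theory Num.Theory.
Import numFieldNormedType.Exports.

Local Open Scope classical_set_scope.
Local Open Scope ring_scope.

(* Column vectors carry the product sigma-algebra generated by the coordinate
   maps, built as the library does for n.-tuple T. On 'cV[R]_k this is the
   Borel sigma-algebra of R^k. *)
Definition measure_cV_display : measure_display -> measure_display.
Proof. exact. Qed.

Section measurable_cV.
Context {disp} {T : sigmaRingType disp} (k : nat).

Let coors : 'I_k -> 'cV[T]_k -> T := fun i x => x i ord0.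

Let cV_set0 : g_sigma_preimage coors set0.
Proof. exact: sigma_algebra0. Qed.

Let cV_setC A : g_sigma_preimage coors A -> g_sigma_preimage coors (~` A).
Proof. exact: sigma_algebraC. Qed.

Let cV_bigcup (F : _^nat) : (forall i, g_sigma_preimage coors (F i)) ->
  g_sigma_preimage coors (\bigcup_i (F i)).
Proof. exact: sigma_algebra_bigcup. Qed.

HB.instance Definition _ := @isMeasurable.Build (measure_cV_display disp)
  'cV[T]_k (g_sigma_preimage coors) cV_set0 cV_setC cV_bigcup.

End measurable_cV.

Lemma measurable_fun_cV d1 d2 (T1 : measurableType d1) (T2 : measurableType d2)
    k (f : T1 -> 'cV[T2]_k) :
  (forall i, measurable_fun [set: T1] (fun x => f x i ord0)) ->
  measurable_fun [set: T1] f.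
Proof.
move=> mf _ A; rewrite setTI.
apply: (@smallest_sub _ _ _ [set A | measurable (f @^-1` A)]).
  split=> /=.
  - by rewrite preimage_set0.
  - by move=> B mB; rewrite setTD preimage_setC; exact: measurableC.
  - by move=> F mF; rewrite preimage_bigcup; exact: bigcup_measurable.
rewrite -bigcup_seq; apply: bigcup_sub => i _ _ [B mB <-] /=.
by rewrite setTI -[X in measurable X]setTI; exact: mf.
Qed.

Section decision.
Context {R : realType}.

(* The n-fold product measure P x ... x P, i.e. the law of n i.i.d. draws. *)
Section iid.
Context {disp} {T : measurableType disp} (P : probability T R).

Section step.
Variables (n : nat) (Q : probability (n.-tuple T) R).

Definition cons_pair (x : T * n.-tuple T) : n.+1.-tuple T :=
  [tuple of x.1 :: x.2].

Let measurable_cons_pair : measurable_fun [set: T * n.-tuple T] cons_pair.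
Proof. exact: measurable_cons. Qed.

HB.instance Definition _ :=
  isMeasurableFun.Build _ _ _ _ cons_pair measurable_cons_pair.

Definition iid_step : probability (n.+1.-tuple T) R :=
  distribution (P \x Q)%E cons_pair.

End step.

Fixpoint iid (n : nat) : probability (n.-tuple T) R :=
  if n is m.+1 then iid_step (iid m) else \d_([tuple] : 0.-tuple T).

End iid.

Local Notation Rm := (measurableTypeR R).

(* N(mu, S) is the law of mu + A z, where z has i.i.d. standard normal
   coordinates and A A^T = S; this law does not depend on the choice of A.
   The second argument of normal_prob is the standard deviation. *)
Section gaussian.
Variable k : nat.

Definition posdefmx (S : 'M[R]_k) : Prop :=
  forall x : 'cV[R]_k, x != 0 -> 0 < (x^T *m S *m x) ord0 ord0.

Definition cov_factor (S : 'M[R]_k) : 'M[R]_k :=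
  xget 0 [set A : 'M[R]_k | A *m A^T = S].

Variables (mu : 'cV[R]_k) (A : 'M[R]_k).

Definition affine_map (z : k.-tuple Rm) : 'cV[R]_k :=
  mu + A *m (\col_i tnth z i).

Let measurable_affine_map : measurable_fun [set: k.-tuple Rm] affine_map.
Proof.
apply: measurable_fun_cV => i.
rewrite (_ : (fun z => _) =
    fun z : k.-tuple Rm => mu i ord0 + \sum_(j < k) A i j * tnth z j).
  apply: measurable_funD => //.
  elim: (index_enum _) => [|j s IH].
    by under eq_fun do rewrite big_nil; exact: measurable_cst.
  under eq_fun do rewrite big_cons.
  apply: measurable_funD => //; apply: measurable_funM => //.
  exact: measurable_tnth.
apply/funext => z; rewrite !mxE; congr (_ + _).
by apply: eq_bigr => j _; rewrite mxE.
Qed.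

HB.instance Definition _ :=
  isMeasurableFun.Build _ _ _ _ affine_map measurable_affine_map.

End gaussian.

Definition gaussian (k : nat) (mu : 'cV[R]_k) (S : 'M[R]_k) :
    probability 'cV[R]_k R :=
  distribution (iid (normal_prob (0 : R) 1) k) (affine_map mu (cov_factor S)).

Lemma cov_factorP k (S : 'M[R]_k) : S^T = S -> posdefmx S ->
  cov_factor S *m (cov_factor S)^T = S.
Proof.
move=> symS pdS; suff [A AS] : exists A : 'M[R]_k, A *m A^T = S.
  by rewrite /cov_factor; case: xgetP => [_ -> //|/(_ A)].
elim: k S symS pdS => [|k IH]; first by move=> S _ _; exists 0; apply/matrixP => -[].
change (k.+1) with (1 + k)%N => S.
rewrite -[S]submxK; set a := ulsubmx S; set b' := ursubmx S.
set b := dlsubmx S; set C := drsubmx S.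
rewrite tr_block_mx => /eq_block_mx[_ b'E _ symC].
have {b' b'E} -> : b' = b^T by rewrite b'E.
rewrite [a]mx11_scalar; set al := a _ _ => pd.
have al0 : 0 < al.
  have := pd (col_mx 1 0); rewrite tr_col_mx mul_row_block mul_row_col.
  rewrite trmx0 !mul0mx !mulmx0 !addr0 trmx1 mul1mx mulmx1 mxE eqxx; apply.
  by apply/eqP => /(congr1 usubmx)/matrixP/(_ 0 0)/eqP; rewrite col_mxKu linear0 !mxE oner_eq0.
have [L LE] : exists L : 'M[R]_k, L *m L^T = C - al^-1 *: (b *m b^T).
  apply: IH => [|y y0].
    by rewrite linearB linearZ /= trmx_mul trmxK symC.
  set w := - al^-1 *: (b^T *m y).
  have := pd (col_mx w y); rewrite tr_col_mx mul_row_block mul_row_col.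
  have wT : w^T = - al^-1 *: (y^T *m b).
    by rewrite /w linearZ /= trmx_mul trmxK.
  have -> : w^T *m al%:M + y^T *m b = 0.
    rewrite mul_mx_scalar wT scalerA mulrN divff ?gt_eqF// scaleN1r; exact: addNr.
  rewrite mul0mx add0r wT -scalemxAl scaleNr.
  rewrite mulmxBr -scalemxAr addrC -mulmxA; apply.
  apply: contra_neq y0 => E.
  by rewrite -(col_mxKd w y) E linear0.
have s0 : 0 < Num.sqrt al by rewrite sqrtr_gt0.
have ss : Num.sqrt al * Num.sqrt al = al by rewrite -expr2 sqr_sqrtr ?ltW.
exists (block_mx (Num.sqrt al)%:M 0 ((Num.sqrt al)^-1 *: b) L).
rewrite tr_block_mx mulmx_block trmx0 !(mul0mx, mulmx0) !addr0.
rewrite tr_scalar_mx linearZ /= mul_scalar_mx mul_mx_scalar scale_scalar_mx ss.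
rewrite mul_scalar_mx !scalerA divff ?gt_eqF// !scale1r.
by rewrite -scalemxAl -scalemxAr scalerA -invfM ss LE addrC subrK.
Qed.

Section decision_problem.
Variables (d n : nat).
Implicit Types (mu x z : 'cV[R]_d) (S : 'M[R]_d) (X : set 'cV[R]_d).

(* The library norm on matrices is the max norm, hence this definition. *)
Definition enorm x : R := Num.sqrt (\sum_(i < d) x i ord0 ^+ 2).

Definition dot (xi x : 'cV[R]_d) : R := (xi^T *m x) ord0 ord0.

Definition ball_set (r : R) : set 'cV[R]_d := [set x | enorm x <= r].

(* F(x, xi); since F is affine in xi, f_mu(x) = E_{xi ~ N(mu, S)}[F(x, xi)]
   is cost x mu. *)
Definition cost x (xi : 'cV[R]_d) : R := 2%:R^-1 * enorm x ^+ 2 - dot xi x.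

(* The infimum is the minimum when X is nonempty and compact. *)
Definition loss X mu x : R := cost x mu - inf [set cost z mu | z in X].

Definition argmin_cost X (xi : 'cV[R]_d) : set 'cV[R]_d :=
  [set x | X x /\ forall z, X z -> cost x xi <= cost z xi].

Definition sample_mean (xi : n.-tuple 'cV[R]_d) : 'cV[R]_d :=
  n%:R^-1 *: \sum_(i < n) tnth xi i.

Definition sample_law S mu : probability (n.-tuple 'cV[R]_d) R :=
  iid (gaussian mu S) n.

Definition decision_rules S X : set (n.-tuple 'cV[R]_d -> 'cV[R]_d) :=
  [set delta | [/\ measurable_fun setT delta,
      (forall xi, X (delta xi)) &
      forall mu (i : 'I_d), (sample_law S mu).-integrable setT
        (fun xi => (delta xi i ord0)%:E)]].

Definition risk S X mu (delta : n.-tuple 'cV[R]_d -> 'cV[R]_d) : \bar R :=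
  'E_(sample_law S mu)[fun xi => loss X mu (delta xi)]%E.

Definition dominates S X (delta' delta : n.-tuple 'cV[R]_d -> 'cV[R]_d) :=
  (forall mu, (risk S X mu delta' <= risk S X mu delta)%E) /\
  (exists mu, (risk S X mu delta' < risk S X mu delta)%E).

Definition admissible S X (delta : n.-tuple 'cV[R]_d -> 'cV[R]_d) : Prop :=
  ~ exists2 delta', decision_rules S X delta' & dominates S X delta' delta.

End decision_problem.

End decision.

(* Main.v *)
Require Import Defs.
From mathcomp Require Import all_boot all_order all_algebra.
From mathcomp Require Import all_classical all_reals all_analysis.
From mathcomp Require Import measurable_realfun ring lra.

Set Implicit Arguments.
Unset Strict Implicit.
Unset Printing Implicit Defensive.

Import Order.TTheory GRing.Theory Num.Theory.
Import numFieldNormedType.Exports.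
Import HBNNSimple.

Local Open Scope classical_set_scope.
Local Open Scope ring_scope.

(** The rule of the theorem is the projection p(m) of the sample mean m on the
    ball, because the cost of x given m is |x - m|^2 / 2 up to a term that does
    not depend on x. It is the Bayes rule for the improper flat prior on mu, and
    admissibility is obtained by Blyth's method: the flat prior is approached by
    Gaussian ones, chosen conjugate and with covariance proportional to Sigma,
    so that the posterior mean of mu is c m with a scalar c < 1 tending to 1.

    The point which makes the argument work in every dimension is that
    projecting c m or m gives the same point as soon as c |m| >= r: only the
    samples with a bounded mean see the difference between the improper and the
    proper prior, and on them the loss in cost is O(1 - c).

    Write Sigma = A A^T, mu = A nu and z = A^-1 m. All computations take place
    under the law P0 of the samples for mu = 0, with respect to which the law
    for mu = A nu has density L_nu = exp (n nu.z - n |nu|^2 / 2)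
    ([sample_density]). Let delta be a rule whose risk nowhere exceeds that of
    p, and v = delta - p. Then the integral of L_nu (cost delta mu - cost p mu)
    under P0 is nonpositive for every nu. Put nu = s w, with w standard Gaussian
    and n s^2 = c < 1, weight by exp (c |w|^2 / 2), and average over w. The
    weight cancels the quadratic term of L_nu, Fubini applies because c < 1, and
    the inner Gaussian integral is explicit; what remains
    ([integral_posterior_le0]) is
      E0 [exp (n c |z|^2 / 2) (cost delta (c m) - cost p (c m))] <= 0.
    For c >= 1/2, strong convexity of the cost and the remark above bound the
    second factor from below by |v|^2 / 2 - 4 r^2 (1 - c) 1_{|m| <= 2 r}
    ([cost_shrunk_proj]). On the event |m| <= 2 r the exponential is bounded
    uniformly in c, and everywhere it is at least 1, so
    E0 [|v|^2 / 2] <= C (1 - c). Letting c tend to 1 shows that delta = p almost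
    surely under P0, hence under every law of the family, and the two risks
    coincide ([same_risk]): no rule dominates p. *)

(** * Integrals against densities *)

Section density.
Local Open Scope ereal_scope.
Context d (T : measurableType d) (R : realType).

(** The hypothesis is the case where g is an indicator; simple functions and
    monotone convergence give the rest. *)
Lemma ge0_integral_density (mu nu : {measure set T -> \bar R}) (f : T -> R)
    (g : T -> \bar R) :
  measurable_fun setT f -> (forall x, (0 <= f x)%R) ->
  (forall A, measurable A -> nu A = \int[mu]_(x in A) (f x)%:E) ->
  measurable_fun setT g -> (forall x, 0 <= g x) ->
  \int[nu]_x g x = \int[mu]_x (g x * (f x)%:E).
Proof.
move=> mf f0 nuE mg g0; have mfE := (measurable_EFinP setT f).2 mf.
pose g_ := nnsfun_approx measurableT mg.
have g_cvg x : (g_ n x)%:E @[n --> \oo] --> g x.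
  by apply: cvg_nnsfun_approx => // *; exact: g0.
have step n : \int[nu]_x (g_ n x)%:E = \int[mu]_x ((g_ n x)%:E * (f x)%:E).
  rewrite integralT_nnsfun sintegralE.
  under [RHS]eq_integral => x _.
    rewrite fimfunE -fsumEFin// ge0_mule_fsuml; last first.
      by move=> r; rewrite EFinM nnfun_muleindic_ge0.
    over.
  rewrite ge0_integral_fsum//; last 2 first.
  - move=> r; apply: emeasurable_funM => //.
    by apply/measurable_EFinP/measurable_funM.
  - move=> r x _; rewrite mule_ge0 ?lee_fin//.
    exact: nnfun_muleindic_ge0.
  apply: eq_fsbigr => r /set_mem[x0 _ <-].
  under eq_integral => x _ do rewrite EFinM -muleA.
  rewrite ge0_integralZl//; last 3 first.
  - apply: emeasurable_funM => //; exact/measurable_EFinP.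
  - by move=> x _; rewrite mule_ge0// lee_fin.
  - by rewrite lee_fin.
  congr (_ * _); rewrite nuE//.
  rewrite integral_mkcond/=; apply: eq_integral => x _.
  rewrite patchE indicE; case: ifP => _; first by rewrite mul1e.
  by rewrite mul0e.
rewrite (_ : \int[nu]_x g x = limn (fun n => \int[nu]_x (g_ n x)%:E)); last first.
  rewrite -monotone_convergence//.
  - by apply: eq_integral => x _; apply/esym/cvg_lim.
  - by move=> n; exact/measurable_EFinP.
  - by move=> n x _; rewrite lee_fin.
  - by move=> x _ m n mn; rewrite lee_fin; exact/lefP/nd_nnsfun_approx.
under eq_fun do rewrite step.
rewrite -monotone_convergence//.
- apply: eq_integral => x _; apply/cvg_lim => //.
  by apply: cvgeZr.
- by move=> n; apply: emeasurable_funM => //; exact/measurable_EFinP.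
- by move=> n x _; rewrite mule_ge0// lee_fin.
- move=> x _ m n mn; apply: lee_wpmul2r; rewrite lee_fin//.
  exact/lefP/nd_nnsfun_approx.
Qed.

(** The nonnegative case applies to the positive and to the negative part of g,
    and the right-hand side splits in the same way because f is nonnegative; no
    integrability is involved, as infinite values match too. *)
Lemma integral_transform d' (T' : measurableType d')
    (Q : {measure set T' -> \bar R}) (P : {measure set T -> \bar R})
    (tau : T' -> T) (f : T -> R) :
  (forall x, (0 <= f x)%R) ->
  (forall g : T -> \bar R, measurable_fun setT g -> (forall x, 0 <= g x) ->
    \int[Q]_x g (tau x) = \int[P]_x (g x * (f x)%:E)) ->
  forall g : T -> \bar R, measurable_fun setT g ->
    \int[Q]_x g (tau x) = \int[P]_x (g x * (f x)%:E).
Proof.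
move=> f0 tauE g mg; rewrite integralE [RHS]integralE; congr (_ - _).
- transitivity (\int[Q]_x g^\+ (tau x)).
    by apply: eq_integral => x _; rewrite !funeposE.
  rewrite (tauE _ (measurable_funepos mg) (@funepos_ge0 _ _ g)).
  apply: eq_integral => x _; rewrite muleC.
  rewrite -(congr1 (fun k => k x) (ge0_funeposM g (f0 x))) !funeposE.
  by rewrite muleC.
- transitivity (\int[Q]_x g^\- (tau x)).
    by apply: eq_integral => x _; rewrite !funenegE.
  rewrite (tauE _ (measurable_funeneg mg) (@funeneg_ge0 _ _ g)).
  apply: eq_integral => x _; rewrite muleC.
  rewrite -(congr1 (fun k => k x) (ge0_funenegM g (f0 x))) !funenegE.
  by rewrite muleC.
Qed.

End density.

(** * Affine changes of variable for the standard normal law *)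

Section affine.
Local Open Scope ereal_scope.
Context (R : realType).
Notation Rm := (measurableTypeR R).
Notation leb := (@lebesgue_measure R).

Let aff (a b : R) (x : Rm) : Rm := (a * x + b)%R.

Let maff a b : measurable_fun setT (aff a b).
Proof. by apply: measurable_funD => //; apply: measurable_funM. Qed.

(** The image of Lebesgue measure under the affine map, rescaled by |a|, gives
    the same mass to intervals as Lebesgue measure, hence is equal to it. *)
Lemma ge0_integral_affine (a b : R) (g : R -> \bar R) : (a != 0)%R ->
  measurable_fun setT g -> (forall x, 0 <= g x) ->
  \int[leb]_x g (a * x + b)%R = (`|a|^-1)%:E * \int[leb]_x g x.
Proof.
move=> a0 mg g0.
have na0 : (0 < `|a|)%R by rewrite normr_gt0.
have nn : (0 <= `|a|)%R by [].
pose m_ := (mscale (NngNum nn) (pushforward leb (aff a b)) :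
  {measure set Rm -> \bar R}).
pose m := m_ (maff a b).
have mE A : measurable A -> leb A = m A.
  apply: lebesgue_measure_unique => {A} _ [[u v] /= _ <-].
  rewrite /m /m_ /mscale/= /pushforward.
  have [agt0|ale0] := ltP 0%R a.
    rewrite (_ : _ @^-1` _ = `]((u - b) / a)%R, ((v - b) / a)%R]%classic); last first.
      apply/seteqP; split => x /=; rewrite !in_itv/= /aff ltr_pdivrMr// ler_pdivlMr//
        [(x * a)%R]mulrC ltrBlDr lerBrDr//.
    rewrite !lebesgue_measure_itv/= !lte_fin ltr_pM2r ?invr_gt0// ltrD2r.
    case: ifP => _; last by rewrite mule0.
    rewrite -!EFinD -EFinM gtr0_norm//; congr EFin; by field.
  have alt0 : (a < 0)%R by rewrite lt_neqAle a0.
  rewrite (_ : _ @^-1` _ = `[((v - b) / a)%R, ((u - b) / a)%R[%classic); last first.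
    apply/seteqP; split => x /=; rewrite !in_itv/= /aff ltr_ndivlMr// ler_ndivrMr//
      [(x * a)%R]mulrC ltrBlDr lerBrDr// => /andP[-> ->]//.
  rewrite !lebesgue_measure_itv/= !lte_fin ltr_nM2r ?invr_lt0// ltrD2r.
  case: ifP => _; last by rewrite mule0.
  rewrite -!EFinD -EFinM ltr0_norm//; congr EFin; by field.
have -> : \int[leb]_x g x = \int[m]_x g x.
  by apply: eq_measure_integral => A mA _; exact: mE.
rewrite /m /m_ ge0_integral_mscale//= ge0_integral_pushforward//=.
by rewrite muleA -EFinM mulVf ?mul1e// gt_eqF.
Qed.

Lemma ge0_integral_normal (m s : R) (g : R -> \bar R) :
  measurable_fun setT g -> (forall x, 0 <= g x) ->
  \int[normal_prob m s]_x g x = \int[leb]_x (g x * (normal_pdf m s x)%:E).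
Proof.
move=> mg g0; apply: ge0_integral_density => //.
- exact: measurable_normal_pdf.
- exact: normal_pdf_ge0.
Qed.

(** The density, with respect to N(0, 1), of the law N(b, a^2) of a X + b. *)
Definition affine_density (a b x : R) : R :=
  `|a|^-1 * expR (x ^+ 2 / 2 - ((x - b) / a) ^+ 2 / 2).

(** Three instances matter: a = 1 (translations), a = -1 (symmetry), and b = 0
    with a >= 1, which computes the integral of exp (c x^2 / 2) for c < 1. *)
Lemma normal_affine (a b : R) (g : R -> \bar R) : (a != 0)%R ->
  measurable_fun setT g -> (forall x, 0 <= g x) ->
  \int[normal_prob 0 1]_x g (a * x + b)%R =
  \int[normal_prob 0 1]_x (g x * (affine_density a b x)%:E).
Proof.
move=> a0 mg g0.
have mpdf : measurable_fun setT (EFin \o @normal_pdf R 0 1).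
  by apply/measurable_EFinP; exact: measurable_normal_pdf.
have maffR c e : measurable_fun setT (fun x : R => c * x + e)%R.
  by apply: measurable_funD => //; apply: measurable_funM.
have md : measurable_fun setT (affine_density a b).
  apply: measurable_funM => //; apply: measurableT_comp => //.
  apply: measurable_funB; first by apply: measurable_funM => //; apply: measurable_funX.
  apply: measurable_funM => //; apply: measurable_funX.
  by apply: measurable_funM => //; apply: measurable_funB.
rewrite ge0_integral_normal//; last exact: (measurableT_comp mg).
rewrite [RHS]ge0_integral_normal//; last 2 first.
- by apply: emeasurable_funM => //; exact/measurable_EFinP.
- by move=> x; rewrite mule_ge0// lee_fin mulr_ge0 ?expR_ge0// invr_ge0.
pose h y := g y * (normal_pdf 0 1 (a^-1 * y + - (a^-1 * b))%R)%:E.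
have -> : \int[leb]_x (g (a * x + b)%R * (normal_pdf 0 1 x)%:E) = \int[leb]_x h (a * x + b)%R.
  apply: eq_integral => x _; rewrite /h; congr (_ * (normal_pdf _ _ _)%:E).
  by field.
have mh : measurable_fun setT h.
  apply: emeasurable_funM => //.
  exact: (measurableT_comp mpdf (maffR _ _)).
have h0 y : 0 <= h y by rewrite mule_ge0// lee_fin normal_pdf_ge0.
rewrite ge0_integral_affine// -ge0_integralZl//; apply: eq_integral => x _.
rewrite /h muleCA -!muleA -!EFinM; congr (_ * _%:E).
rewrite /affine_density -[RHS]mulrA; congr (_ * _)%R.
rewrite !normal_pdfE ?oner_neq0// mulrCA; congr (_ * _)%R.
rewrite /normal_fun -expRD !subr0 expr1n; congr expR.
by field.
Qed.

End affine.

(** * Coordinatewise transformations of i.i.d. samples *)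

Section iid_transform.
Local Open Scope ereal_scope.
Context (R : realType) d d' (T : measurableType d) (T' : measurableType d').
Variables (P : probability T R) (P' : probability T' R).

Definition coordwise k (tau : 'I_k -> T' -> T) (z : k.-tuple T') : k.-tuple T :=
  [tuple tau i (tnth z i) | i < k].

Lemma measurable_coordwise k (tau : 'I_k -> T' -> T) :
  (forall i, measurable_fun setT (tau i)) -> measurable_fun setT (coordwise tau).
Proof.
move=> mtau; apply/measurable_fun_tnthP => i.
rewrite (_ : _ \o _ = tau i \o (@tnth _ T' ^~ i)).
  by apply: measurableT_comp => //; exact: measurable_tnth.
by apply/funext => z /=; rewrite tnth_mktuple.
Qed.

Lemma measurable_prod_tnth k (f : 'I_k -> T -> R) :
  (forall i, measurable_fun setT (f i)) ->
  measurable_fun setT (fun z : k.-tuple T => \prod_(i < k) f i (tnth z i))%R.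
Proof.
move=> mf; apply: measurable_prod => i _.
by apply: (measurableT_comp (mf i)); exact: measurable_tnth.
Qed.

(** If tau_i carries P' to a law of density f_i with respect to P, then the
    coordinatewise map carries a product of copies of P' to the law whose density
    is the product of the f_i. The maps depend on the coordinate so that the
    lemma covers translations by a vector; with tau_i the identity it compares
    the laws of samples drawn from P' and from P. *)
Lemma iid_transform k (tau : 'I_k -> T' -> T) (f : 'I_k -> T -> R) :
  (forall i, measurable_fun setT (tau i)) ->
  (forall i, measurable_fun setT (f i)) -> (forall i x, (0 <= f i x)%R) ->
  (forall i (g : T -> \bar R), measurable_fun setT g -> (forall x, 0 <= g x) ->
    \int[P']_x g (tau i x) = \int[P]_x (g x * (f i x)%:E)) ->
  forall g : k.-tuple T -> \bar R, measurable_fun setT g ->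
  (forall z, 0 <= g z) ->
  \int[iid P' k]_z g (coordwise tau z) =
  \int[iid P k]_z (g z * (\prod_(i < k) f i (tnth z i))%:E).
Proof.
elim: k tau f => [|k IH] tau f mtau mf f0 tauE g mg g0.
  rewrite /= !integral_dirac//=; last 2 first.
  - under eq_fun do rewrite big_ord0 mule1. by [].
  - by apply: (measurableT_comp mg); exact: measurable_coordwise.
  by rewrite !diracT !mul1e big_ord0 mule1; congr g; apply/eq_from_tnth => -[].
have mgc : measurable_fun setT (g \o @cons_pair _ T k).
  by apply: (measurableT_comp mg); exact: measurable_cons.
have mprod := measurable_prod_tnth (fun i => mf (lift ord0 i)).
have prod0 z : (0 <= \prod_(i < k) f (lift ord0 i) (tnth z i))%R.
  exact: prodr_ge0.
rewrite /= /iid_step ge0_integral_distribution//; last first.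
  by apply: (measurableT_comp mg); exact: measurable_coordwise.
rewrite ge0_integral_distribution//; last 2 first.
- apply: emeasurable_funM => //; apply/measurable_EFinP.
  exact: measurable_prod_tnth.
- by move=> z; rewrite mule_ge0// lee_fin prodr_ge0.
have ctE (x : T') (z : k.-tuple T') : coordwise tau (cons_pair (x, z)) =
    cons_pair (tau ord0 x, coordwise (fun i => tau (lift ord0 i)) z).
  apply/eq_from_tnth => i; rewrite tnth_mktuple /cons_pair/=.
  by have [j ->|->] := unliftP ord0 i; rewrite !(tnthS, tnth0)// tnth_mktuple.
pose G y := \int[iid P k]_z (g (cons_pair (y, z)) *
   (\prod_(i < k) f (lift ord0 i) (tnth z i))%:E).
have mG2 : measurable_fun setT (fun yz : T * k.-tuple T => g (cons_pair yz) *
   (\prod_(i < k) f (lift ord0 i) (tnth yz.2 i))%:E).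
  apply: emeasurable_funM => //; apply/measurable_EFinP.
  exact: (measurableT_comp mprod).
have G20 yz : 0 <= g (cons_pair yz) *
   (\prod_(i < k) f (lift ord0 i) (tnth yz.2 i))%:E.
  by rewrite mule_ge0// lee_fin.
have mgt : measurable_fun setT (fun z => g (coordwise tau z)).
  by apply: (measurableT_comp mg); exact: measurable_coordwise.
rewrite fubini_tonelli1; last 2 first.
- by apply: (measurableT_comp mgt); exact: measurable_cons.
- by move=> z; exact: g0.
rewrite fubini_tonelli1; last 2 first.
- apply: emeasurable_funM => //; apply/measurable_EFinP => /=.
  apply: (measurableT_comp (measurable_prod_tnth mf)).
  exact: measurable_cons.
- by move=> z; rewrite /= mule_ge0// lee_fin prodr_ge0.
transitivity (\int[P']_x G (tau ord0 x)).
  apply: eq_integral => x _; rewrite /fubini_F /G /=.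
  under eq_integral do rewrite ctE.
  rewrite (IH _ (fun i => f (lift ord0 i)) _ _ _ _
    (fun z => g (cons_pair (tau ord0 x, z))))//.
    by move=> i; exact: tauE.
  exact: (measurableT_comp mgc).
rewrite tauE//; last 2 first.
- exact: (measurable_fun_fubini_tonelli_F _ mG2 G20).
- by move=> x; apply: integral_ge0.
apply: eq_integral => x _; rewrite /fubini_F /G /= -ge0_integralZr//; last 2 first.
- exact: (measurableT_comp mG2).
- by rewrite lee_fin.
apply: eq_integral => z _; rewrite -muleA -EFinM; congr (_ * _%:E).
rewrite big_ord_recl mulrC; congr (_ * _)%R.
by apply: eq_bigr => i _; rewrite /cons_pair/= tnthS.
Qed.

End iid_transform.

(** * The Euclidean inner product *)

Section dot.
Context (R : realType) (k : nat).
Implicit Types (x y z : 'cV[R]_k) (a : R).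

Lemma dotE x y : dot x y = \sum_(i < k) x i ord0 * y i ord0.
Proof. by rewrite /dot mxE; apply: eq_bigr => i _; rewrite mxE. Qed.

Lemma dotC x y : dot x y = dot y x.
Proof. by rewrite !dotE; apply: eq_bigr => i _; rewrite mulrC. Qed.

Lemma dotDl x y z : dot (x + y) z = dot x z + dot y z.
Proof. by rewrite /dot linearD/= mulmxDl mxE. Qed.

Lemma dotZl a x y : dot (a *: x) y = a * dot x y.
Proof. by rewrite /dot linearZ/= -scalemxAl mxE. Qed.

Lemma dot0l x : dot 0 x = 0.
Proof. by rewrite -(scale0r 0) dotZl mul0r. Qed.

Lemma dotNl x y : dot (- x) y = - dot x y.
Proof. by rewrite -scaleN1r dotZl mulN1r. Qed.

Lemma dotBl x y z : dot (x - y) z = dot x z - dot y z.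
Proof. by rewrite dotDl dotNl. Qed.

Lemma dotDr x y z : dot x (y + z) = dot x y + dot x z.
Proof. by rewrite dotC dotDl !(dotC x). Qed.

Lemma dotZr a x y : dot x (a *: y) = a * dot x y.
Proof. by rewrite dotC dotZl dotC. Qed.

Lemma dotBr x y z : dot x (y - z) = dot x y - dot x z.
Proof. by rewrite dotC dotBl !(dotC x). Qed.

Lemma dot_suml I (r : seq I) (F : I -> 'cV[R]_k) x :
  dot (\sum_(i <- r) F i) x = \sum_(i <- r) dot (F i) x.
Proof.
apply: (big_morph (fun y => dot y x)) => [y z|]; first exact: dotDl.
exact: dot0l.
Qed.

Lemma dot_ge0 x : 0 <= dot x x.
Proof. by rewrite dotE sumr_ge0// => i _; rewrite -expr2 sqr_ge0. Qed.

Lemma dot_eq0 x : dot x x = 0 -> x = 0.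
Proof.
rewrite dotE => /psumr_eq0P xx0; apply/matrixP => i j.
rewrite (ord1 j) mxE; apply/eqP; rewrite -sqrf_eq0 expr2.
by apply/eqP/xx0 => // l _; rewrite -expr2 sqr_ge0.
Qed.

Lemma sqr_enorm x : enorm x ^+ 2 = dot x x.
Proof.
rewrite /enorm sqr_sqrtr ?dotE; first by apply: eq_bigr => i _; rewrite expr2.
by apply: sumr_ge0 => i _; rewrite sqr_ge0.
Qed.

Lemma enorm_ge0 x : 0 <= enorm x. Proof. exact: sqrtr_ge0. Qed.

Lemma enorm_le (r : R) x : 0 <= r -> (enorm x <= r) = (dot x x <= r ^+ 2).
Proof. by move=> r0; rewrite -sqr_enorm ler_pXn2r// nnegrE ?enorm_ge0. Qed.

Lemma dot_le_enorm x y : dot x y <= enorm x * enorm y.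
Proof.
have [->|x0] := eqVneq x 0.
  by rewrite dot0l mulr_ge0 ?enorm_ge0.
have [->|y0] := eqVneq y 0.
  by rewrite dotC dot0l mulr_ge0 ?enorm_ge0.
have pos z : z != 0 -> 0 < enorm z.
  move=> z0; rewrite lt_neqAle enorm_ge0 andbT eq_sym.
  by apply: contra_neq z0 => z0; apply: dot_eq0; rewrite -sqr_enorm z0 expr0n.
have := dot_ge0 (enorm y *: x - enorm x *: y).
rewrite dotBl !dotBr !dotZl !dotZr -!sqr_enorm (dotC y x).
have -> : enorm y * (enorm y * enorm x ^+ 2) - enorm y * (enorm x * dot x y) -
  (enorm x * (enorm y * dot x y) - enorm x * (enorm x * enorm y ^+ 2)) =
  2 * (enorm x * enorm y) * (enorm x * enorm y - dot x y) by ring.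
by rewrite pmulr_rge0 ?subr_ge0// !mulr_gt0 ?pos.
Qed.

End dot.

Lemma dot_mulmx (R : realType) k l (A : 'M[R]_(k, l)) x y :
  dot (A *m x) y = dot x (A^T *m y).
Proof. by rewrite /dot trmx_mul mulmxA. Qed.

(** * Measurability of vector-valued maps *)

Section measurable_cV.
Context (R : realType).

Lemma measurable_coord k (i : 'I_k) :
  measurable_fun setT (fun x : 'cV[R]_k => x i ord0).
Proof.
move=> _ Y mY; rewrite setTI; apply: sub_sigma_algebra => /=.
rewrite -bigcup_seq/=; exists i => /=; first by rewrite mem_index_enum.
by exists Y => //; rewrite setTI.
Qed.

Context d (T : measurableType d) (k : nat).
Implicit Types f g : T -> 'cV[R]_k.

Lemma measurable_coord_comp f i : measurable_fun setT f ->
  measurable_fun setT (fun t => f t i ord0).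
Proof. exact: (measurableT_comp (measurable_coord i)). Qed.

Lemma measurable_addcV f g : measurable_fun setT f -> measurable_fun setT g ->
  measurable_fun setT (fun t => f t + g t).
Proof.
move=> mf mg; apply: measurable_fun_cV => i; under eq_fun do rewrite mxE.
by apply: measurable_funD; exact: measurable_coord_comp.
Qed.

Lemma measurable_subcV f g : measurable_fun setT f -> measurable_fun setT g ->
  measurable_fun setT (fun t => f t - g t).
Proof.
move=> mf mg; apply: measurable_fun_cV => i; under eq_fun do rewrite !mxE.
by apply: measurable_funB; exact: measurable_coord_comp.
Qed.

Lemma measurable_scalecV (a : T -> R) f :
  measurable_fun setT a -> measurable_fun setT f ->
  measurable_fun setT (fun t => a t *: f t).
Proof.
move=> ma mf; apply: measurable_fun_cV => i; under eq_fun do rewrite mxE.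
by apply: measurable_funM => //; exact: measurable_coord_comp.
Qed.

Lemma measurable_mulcV l (A : 'M[R]_(l, k)) f : measurable_fun setT f ->
  measurable_fun setT (fun t => A *m f t).
Proof.
move=> mf; apply: measurable_fun_cV => i; under eq_fun do rewrite mxE.
apply: measurable_sum => j; apply: measurable_funM => //.
exact: measurable_coord_comp.
Qed.

Lemma measurable_dot f g : measurable_fun setT f -> measurable_fun setT g ->
  measurable_fun setT (fun t => dot (f t) (g t)).
Proof.
move=> mf mg; under eq_fun do rewrite dotE.
by apply: measurable_sum => j; apply: measurable_funM; exact: measurable_coord_comp.
Qed.

End measurable_cV.

(** * The standard Gaussian vector *)

Section gaussian_vector.
Local Open Scope ereal_scope.
Context (R : realType) (k : nat).

(** Every gaussian mu S is the image of this law under an affine map, which moves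
    all computations from tuples of reals to vectors. *)
Definition std_gaussian : probability 'cV[R]_k R :=
  distribution (iid (normal_prob (0 : R) 1) k) (affine_map (0 : 'cV[R]_k) 1%:M).

Lemma ge0_integral_std (g : 'cV[R]_k -> \bar R) :
  measurable_fun setT g -> (forall x, 0 <= g x) ->
  \int[std_gaussian]_x g x =
  \int[iid (normal_prob (0 : R) 1) k]_z g (\col_i tnth z i)%R.
Proof.
move=> mg g0; rewrite /std_gaussian ge0_integral_distribution//.
apply: eq_integral => z _; congr (g _).
by rewrite -[RHS]mul1mx -[RHS]add0r.
Qed.

Lemma measurable_col :
  measurable_fun setT (fun z : k.-tuple (measurableTypeR R) => \col_i tnth z i)%R.
Proof.
apply: measurable_fun_cV => i; under eq_fun do rewrite mxE.
exact: measurable_tnth.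
Qed.

Lemma std_affine (a : R) (b : 'cV[R]_k) (g : 'cV[R]_k -> \bar R) : (a != 0)%R ->
  measurable_fun setT g ->
  \int[std_gaussian]_x g (a *: x + b)%R =
  \int[std_gaussian]_x (g x * (`|a| ^- k *
    expR (dot x x / 2 - dot (x - b) (x - b) / (2 * a ^+ 2)))%:E).
Proof.
move=> a0; move: g.
apply: (@integral_transform _ _ _ _ _ std_gaussian std_gaussian (fun x => a *: x + b)%R
  (fun x => `|a| ^- k * expR (dot x x / 2 - dot (x - b) (x - b) / (2 * a ^+ 2)))%R).
  by move=> x; rewrite mulr_ge0 ?expR_ge0// invr_ge0 exprn_ge0.
move=> g mg g0; have mab : measurable_fun setT (fun x : 'cV[R]_k => a *: x + b)%R.
  by apply: measurable_addcV => //; exact: measurable_scalecV.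
rewrite ge0_integral_std//; last exact: (measurableT_comp mg).
rewrite ge0_integral_std//; last 2 first.
- apply: emeasurable_funM => //; apply/measurable_EFinP.
  apply: measurable_funM => //; apply: measurableT_comp => //.
  apply: measurable_funB; apply: measurable_funM => //; apply: measurable_dot => //;
    by apply: measurable_subcV.
- by move=> x; rewrite mule_ge0// lee_fin mulr_ge0 ?expR_ge0// invr_ge0 exprn_ge0.
pose tau (i : 'I_k) (x : measurableTypeR R) : measurableTypeR R := (a * x + b i ord0)%R.
pose f (i : 'I_k) (x : measurableTypeR R) := affine_density a (b i ord0) x.
transitivity (\int[iid (normal_prob (0 : R) 1) k]_z
   g ((\col_i tnth (coordwise tau z) i)%R)).
  apply: eq_integral => z _; congr g; apply/matrixP => i j.
  by rewrite !mxE tnth_mktuple (ord1 j).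
rewrite (@iid_transform _ _ _ _ _ (normal_prob 0 1) (normal_prob 0 1) k tau f _ _ _ _
  (fun z => g (\col_i tnth z i)%R)).
- apply: eq_integral => z _; congr (_ * _%:E).
  rewrite /f /affine_density big_split/= prodr_const card_ord exprVn; congr (_ * _)%R.
  rewrite -expR_sum; congr expR; rewrite !dotE sumrB -!mulr_suml invfM mulrA.
  congr (_ - _)%R.
    by congr (_ / _)%R; apply: eq_bigr => i _; rewrite !mxE expr2.
  rewrite mulrAC; congr (_ / _)%R; rewrite mulr_suml.
  by apply: eq_bigr => i _; rewrite !mxE expr_div_n expr2.
- by move=> i; apply: measurable_funD => //; apply: measurable_funM.
- move=> i; apply: measurable_funM => //; apply: measurableT_comp => //.
  apply: measurable_funB; first by apply: measurable_funM => //; apply: measurable_funX.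
  apply: measurable_funM => //; apply: measurable_funX.
  by apply: measurable_funM => //; apply: measurable_funB.
- by move=> i x; rewrite mulr_ge0 ?expR_ge0// invr_ge0.
- by move=> i h mh h0; exact: normal_affine.
- exact: (measurableT_comp mg measurable_col).
- by move=> z; exact: g0.
Qed.

(** The Cameron-Martin formula. *)
Lemma std_shift (t : 'cV[R]_k) (g : 'cV[R]_k -> \bar R) :
  measurable_fun setT g ->
  \int[std_gaussian]_x g (x + t)%R =
  \int[std_gaussian]_x (g x * (expR (dot t x - dot t t / 2))%:E).
Proof.
move=> mg.
transitivity (\int[std_gaussian]_x g (1 *: x + t)%R).
  by apply: eq_integral => x _; rewrite scale1r.
rewrite std_affine ?oner_neq0//; apply: eq_integral => x _; congr (_ * _%:E).
rewrite normr1 !expr1n invr1 mul1r mulr1; congr expR.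
rewrite dotBl !dotBr (dotC x t); by field.
Qed.

Lemma std_opp (g : 'cV[R]_k -> \bar R) :
  measurable_fun setT g ->
  \int[std_gaussian]_x g (- x)%R = \int[std_gaussian]_x g x.
Proof.
move=> mg.
transitivity (\int[std_gaussian]_x g (-1 *: x + 0)%R).
  by apply: eq_integral => x _; rewrite scaleN1r addr0.
rewrite std_affine ?oppr_eq0 ?oner_neq0//; apply: eq_integral => x _.
by rewrite normrN normr1 expr1n invr1 mul1r sqrrN expr1n mulr1 subr0 subrr expR0 mule1.
Qed.

(** Dilating by (1 - c)^(-1/2) turns the constant function 1 into a multiple of
    exp (c |x|^2 / 2), whose integral is therefore (1 - c)^(-k/2). *)
Lemma std_exp_sqr (c : R) : (0 <= c < 1)%R ->
  \int[std_gaussian]_x (expR (c * dot x x / 2))%:E < +oo.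
Proof.
move=> /andP[c0 c1]; have c10 : (0 < 1 - c)%R by rewrite subr_gt0.
pose a := Num.sqrt (1 - c)^-1.
have agt0 : (0 < a)%R by rewrite sqrtr_gt0 invr_gt0.
have a2 : (a ^+ 2 = (1 - c)^-1)%R by rewrite sqr_sqrtr// ltW// invr_gt0.
have := @std_affine a 0 (cst 1) (lt0r_neq0 agt0) (measurable_cst _).
rewrite integral_cst// mul1e [X in X = _]probability_setT.
have me : measurable_fun setT (fun x : 'cV[R]_k => (expR (c * dot x x / 2))%:E).
  apply/measurable_EFinP; apply: measurableT_comp => //.
  by apply: measurable_funM => //; apply: measurable_funM => //; apply: measurable_dot.
under eq_integral => x _.
  rewrite mul1e EFinM subr0 a2.
  rewrite (_ : (_ - _)%R = (c * dot x x / 2)%R); last by field; rewrite gt_eqF.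
  over.
rewrite ge0_integralZl// gtr0_norm//.
move: (\int[_]_x _) => [r _||]; [exact: ltry| |by rewrite ltNye].
by rewrite gt0_muley// lte_fin invr_gt0 exprn_gt0.
Qed.

End gaussian_vector.

(** * Likelihood ratios of Gaussian samples *)

Lemma unitmx_factor (R : realType) k (A S : 'M[R]_k) :
  posdefmx S -> A *m A^T = S -> A \in unitmx.
Proof.
move=> pdS AS; rewrite -row_free_unit -kermx_eq0; apply/negPn/negP => /rowV0Pn.
move=> [v /sub_kermxP vA v0].
have := pdS v^T; rewrite trmxK -AS mulmxA vA !mul0mx mxE ltxx => /(_ _)/notF; apply.
by apply: contra_neq v0 => vT; rewrite -[v]trmxK vT trmx0.
Qed.

Section gaussian_density.
Local Open Scope ereal_scope.
Context (R : realType) (k : nat) (S : 'M[R]_k).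
Hypotheses (symS : (S^T = S)%R) (pdS : posdefmx S).
Let A := cov_factor S.
Let Au : A \in unitmx.
Proof. exact: unitmx_factor pdS (cov_factorP symS pdS). Qed.

Lemma ge0_integral_gaussian mu (g : 'cV[R]_k -> \bar R) :
  measurable_fun setT g -> (forall x, 0 <= g x) ->
  \int[gaussian mu S]_x g x = \int[std_gaussian R k]_x g (mu + A *m x)%R.
Proof.
move=> mg g0; rewrite /gaussian ge0_integral_distribution// ge0_integral_std//.
by apply: (measurableT_comp mg); apply: measurable_addcV => //; exact: measurable_mulcV.
Qed.

(** The log-likelihood ratio of N(A nu, S) to N(0, S), where A A^T = S. *)
Definition log_density (nu x : 'cV[R]_k) : R :=
  dot nu (invmx (cov_factor S) *m x) - dot nu nu / 2.

Lemma measurable_log_density nu : measurable_fun setT (log_density nu).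
Proof.
by apply: measurable_funB => //; apply: measurable_dot => //; exact: measurable_mulcV.
Qed.

Lemma gaussian_density nu (g : 'cV[R]_k -> \bar R) :
  measurable_fun setT g -> (forall x, 0 <= g x) ->
  \int[gaussian (A *m nu) S]_x g x =
  \int[gaussian 0 S]_x (g x * (expR (log_density nu x))%:E).
Proof.
move=> mg g0; rewrite ge0_integral_gaussian// ge0_integral_gaussian; last 2 first.
- apply: emeasurable_funM => //; apply/measurable_EFinP.
  by apply: measurableT_comp => //; exact: measurable_log_density.
- by move=> x; rewrite mule_ge0// lee_fin expR_ge0.
have mgA : measurable_fun setT (fun x => g (A *m x)).
  by apply: (measurableT_comp mg); exact: measurable_mulcV.
transitivity (\int[std_gaussian R k]_x g (A *m (x + nu))).
  by apply: eq_integral => x _; rewrite mulmxDr addrC.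
rewrite (std_shift _ mgA); apply: eq_integral => x _.
by rewrite add0r /log_density -/A mulKmx.
Qed.

Context (n : nat).
Hypothesis n0 : (0 < n)%N.
Notation N := (n%:R : R).

Lemma measurable_sample_mean :
  measurable_fun setT (@sample_mean R k n).
Proof.
apply: (@measurable_scalecV _ _ _ _ (cst N^-1%R)) => //.
apply: measurable_fun_cV => i; under eq_fun do rewrite summxE; apply: measurable_sum => j.
apply: measurable_coord_comp; exact: measurable_tnth.
Qed.

(** The sample mean in the coordinates where the covariance is the identity. *)
Definition whitened_mean (xi : n.-tuple 'cV[R]_k) : 'cV[R]_k :=
  (invmx (cov_factor S) *m sample_mean xi)%R.

Lemma measurable_whitened_mean : measurable_fun setT whitened_mean.
Proof. exact: (measurable_mulcV _ measurable_sample_mean). Qed.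

(** The mean is a sufficient statistic: the sample enters the likelihood ratio
    only through it. *)
Lemma sample_density nu (g : n.-tuple 'cV[R]_k -> \bar R) :
  measurable_fun setT g ->
  \int[sample_law n S (A *m nu)]_x g x =
  \int[sample_law n S 0]_x (g x *
    (expR (N * dot nu (whitened_mean x) - N * dot nu nu / 2))%:E).
Proof.
move: g.
apply: (@integral_transform _ _ _ _ _ (sample_law n S (A *m nu)) (sample_law n S 0) id
  (fun x => expR (N * dot nu (whitened_mean x) - N * dot nu nu / 2)%R)).
  by move=> x; exact: expR_ge0.
move=> g mg g0; rewrite /sample_law.
transitivity (\int[iid (gaussian (A *m nu) S) n]_z
   g (coordwise (fun=> id) z)).
  apply: eq_integral => z _; congr g; apply: eq_from_tnth => i.
  by rewrite tnth_mktuple.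
rewrite (@iid_transform _ _ _ _ _ (gaussian 0 S) (gaussian (A *m nu) S) n
  (fun=> id) (fun=> expR \o log_density nu))//.
- apply: eq_integral => z _; congr (_ * _%:E).
  rewrite -expR_sum; congr expR.
  rewrite /log_density sumrB sumr_const card_ord -[(_ *+ _)%R in LHS]mulr_natl.
  rewrite mulrA; congr (_ - _)%R.
  rewrite /whitened_mean /sample_mean -scalemxAr dotZr mulrA divff ?mul1r; last first.
    by rewrite pnatr_eq0 -lt0n.
  by rewrite mulmx_sumr dotC dot_suml; apply: eq_bigr => i _; rewrite dotC.
- by move=> _; apply: measurableT_comp => //; exact: measurable_log_density.
- by move=> _ x; rewrite expR_ge0.
- by move=> _ h mh h0; exact: gaussian_density.
Qed.

End gaussian_density.

(** * Averaging over a Gaussian prior *)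

Lemma half_gap (R : realFieldType) (c : R) : 0 < c < 1 ->
  0 <= c + (1 - c) / 2 < 1.
Proof. by move=> c01; lra. Qed.

Section posterior.
Local Open Scope ereal_scope.
Context (R : realType) (k : nat).
Implicit Types (w u t : 'cV[R]_k).

(** Weighted Young inequality for the inner product, followed by 1 + x <= exp x.
    The rate e is arbitrary, so that an affine factor costs as little as desired
    in the exponent of a Gaussian integral. *)
Lemma affine_le_exp (e K h : R) w u : (0 < e)%R -> (`|h| <= K)%R ->
  (dot u u <= K)%R ->
  (`|h - dot w u| <= (1 + K + K / (2 * e)) * expR (e * dot w w / 2))%R.
Proof.
move=> e0 hK uK.
have K0 : (0 <= K)%R by exact: le_trans (dot_ge0 u) uK.
have wu : (`|dot w u| <= (e * dot w w + K / e) / 2)%R.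
  have le1 : (`|e * dot w u| <= (e ^+ 2 * dot w w + K) / 2)%R.
    have := dot_ge0 (e *: w + u); have := dot_ge0 (e *: w - u).
    rewrite dotBl !dotBr dotDl !dotDr !dotZl !dotZr (dotC u w) => p q.
    by rewrite ler_norml; apply/andP; split; lra.
  rewrite -(ler_pM2l e0) -{1}(gtr0_norm e0) -normrM (le_trans le1)//.
  by rewrite [leRHS](_ : _ = (e ^+ 2 * dot w w + K) / 2)%R//; field; rewrite gt_eqF.
have ww := dot_ge0 w.
have := expR_ge1Dx (e * dot w w / 2)%R; set E := expR _ => E1.
have y0 : (0 <= e * dot w w / 2)%R by rewrite divr_ge0// mulr_ge0// ltW.
have Ke : (0 <= K / (2 * e))%R by rewrite divr_ge0// mulr_ge0// ltW.
rewrite (le_trans (ler_normB _ _))//.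
apply: (@le_trans _ _ ((1 + K + K / (2 * e)) * (1 + e * dot w w / 2)))%R; last first.
  by rewrite ler_wpM2l// !addr_ge0.
have -> : ((1 + K + K / (2 * e)) * (1 + e * dot w w / 2) =
  K + (e * dot w w + K / e) / 2 + (1 + (K + K / (2 * e)) * (e * dot w w / 2)))%R.
  by field; rewrite gt_eqF.
rewrite (le_trans (lerD hK wu))// lerDl addr_ge0// mulr_ge0// addr_ge0//.
Qed.

Lemma measurable_exp_sqr (c : R) :
  measurable_fun setT (fun w => expR (c * dot w w / 2)).
Proof.
apply: measurableT_comp => //.
by apply: measurable_funM => //; apply: measurable_funM => //; apply: measurable_dot.
Qed.

Lemma integrable_exp_sqr (c : R) : (0 <= c < 1)%R ->
  (std_gaussian R k).-integrable setT (fun w => (expR (c * dot w w / 2))%:E).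
Proof.
move=> c01; apply/integrableP; split.
  by apply/measurable_EFinP; exact: measurable_exp_sqr.
under eq_integral do rewrite gee0_abs ?lee_fin ?expR_ge0//.
exact: std_exp_sqr.
Qed.

Lemma integrable_std_affine (h : R) u :
  (std_gaussian R k).-integrable setT (fun w => (h - dot w u)%:E).
Proof.
pose K := (`|h| + dot u u)%R.
have hK : (`|h| <= K)%R by rewrite lerDl dot_ge0.
have uK : (dot u u <= K)%R by rewrite lerDr.
have e0 : (0 < 2^-1 :> R)%R by [].
apply: (@le_integrable _ _ _ _ _ _ _ (fun w =>
   (1 + K + K / (2 * 2^-1))%:E * (expR (2^-1 * dot w w / 2))%:E)) => //.
- apply/measurable_EFinP; apply: measurable_funB => //.
  exact: measurable_dot.
- move=> w _; rewrite -EFinM lee_fin [leRHS]ger0_norm; first exact: affine_le_exp.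
  (* the bound is nonnegative, as it dominates an absolute value *)
  by apply: le_trans (affine_le_exp w e0 hK uK).
- by apply: integrableZl => //; apply: integrable_exp_sqr; lra.
Qed.

(** The linear term disappears by symmetry: the integral keeps its value when u
    is replaced by - u, and the sum of the two is 2 h. *)
Lemma integral_std_affine (h : R) u :
  \int[std_gaussian R k]_w (h - dot w u)%:E = h%:E.
Proof.
have mi a v : measurable_fun setT (fun w => (a - dot w v)%:E).
  exact: measurable_int (integrable_std_affine _ _).
set J := LHS.
have JE : \int[std_gaussian R k]_w (h - dot w (- u)%R)%:E = J.
  rewrite /J -(std_opp (mi h u)); apply: eq_integral => w _.
  by rewrite dotNl (dotC w (- u)) dotNl (dotC u).
have Jfin : J \is a fin_num.
  exact: integrable_fin_num (integrable_std_affine _ _).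
have : J + J = (h + h)%:E.
  rewrite -{2}JE /J -integralD_EFin//; [|exact: integrable_std_affine..].
  rewrite -[RHS]mule1 -(probability_setT (std_gaussian R k)) -integral_cst//.
  apply: eq_integral => w _; rewrite /= -EFinD (dotC w (- u)) dotNl (dotC u); congr EFin.
  by ring.
rewrite -(fineK Jfin) -EFinD => -[] JJ; congr EFin; lra.
Qed.

(** Tilting the standard Gaussian law by exp (t.w) moves its mean to t; this
    is the computation of the posterior mean. *)
Lemma integral_std_exp_affine (h : R) t u :
  \int[std_gaussian R k]_w (expR (dot t w) * (h - dot w u))%:E =
  (expR (dot t t / 2) * (h - dot t u))%:E.
Proof.
have mg : measurable_fun setT
    (fun w => (expR (dot t t / 2) * (h - dot w u))%:E).
  apply/measurable_EFinP; apply: measurable_funM => //.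
  apply: measurable_funB => //; exact: measurable_dot.
transitivity (\int[std_gaussian R k]_w (expR (dot t t / 2) * (h - dot (w + t) u))%:E).
  rewrite (std_shift t mg); apply: eq_integral => w _.
  rewrite -EFinM expRB; congr EFin; field.
  by rewrite gt_eqF// expR_gt0.
under eq_integral => w _.
  rewrite EFinM dotDl (_ : h - _ = (h - dot t u) - dot w u)%R; last by ring.
  over.
rewrite integralZl//; last exact: integrable_std_affine.
by rewrite integral_std_affine -EFinM.
Qed.

(* In the application P is the law of the sample for nu = 0, z the whitened mean,
   L nu the likelihood ratio, and h - nu.u the difference of the costs of two
   rules, which is affine in nu. *)
Context d (T : measurableType d) (P : probability T R).
Context (z u : T -> 'cV[R]_k) (h : T -> R) (N K c : R).
Hypotheses (mz : measurable_fun setT z) (mfu : measurable_fun setT u).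
Hypotheses (mh : measurable_fun setT h) (N0 : (0 < N)%R).
Hypotheses (hK : forall x, (`|h x| <= K)%R) (uK : forall x, (dot (u x) (u x) <= K)%R).
Hypothesis c01 : (0 < c < 1)%R.
Let L nu x := expR (N * dot nu (z x) - N * dot nu nu / 2).
Hypothesis L1 : forall nu, \int[P]_x (L nu x)%:E = 1.
Hypothesis risk_le0 : forall nu, \int[P]_x ((h x - dot nu (u x)) * L nu x)%:E <= 0.

Let psi x := (expR (N * c * dot (z x) (z x) / 2) * (h x - c * dot (z x) (u x)))%R.

(* The prior is the law of s w for w standard Gaussian, weighted by
   exp (c |w|^2 / 2); the identity N s^2 = c makes this weight absorb the
   quadratic term of L (s w), which leaves the tilt exp (N s z.w) in phi. *)
Let s := Num.sqrt (c / N).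
Let phi (xw : T * 'cV[R]_k) :=
  (expR (dot ((N * s) *: z xw.1) xw.2) * (h xw.1 - dot xw.2 (s *: u xw.1)))%R.

Let Ns2 : (N * s * s = c)%R.
Proof.
case/andP: c01 => c0 _.
rewrite -mulrA -expr2 sqr_sqrtr; last by rewrite divr_ge0// ltW.
by rewrite mulrC divfK// gt_eqF.
Qed.

Let mphi : measurable_fun setT phi.
Proof.
apply: measurable_funM.
  apply: measurableT_comp => //; apply: measurable_dot => //.
  apply: (@measurable_scalecV _ _ _ _ (cst (N * s)%R)) => //.
  exact: (measurableT_comp mz).
apply: measurable_funB; first exact: (measurableT_comp mh).
apply: measurable_dot => //.
apply: (@measurable_scalecV _ _ _ _ (cst s)) => //.
exact: (measurableT_comp mfu).
Qed.

Let mL nu : measurable_fun setT (L nu).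
Proof.
apply: measurableT_comp => //; apply: measurable_funB => //.
by apply: measurable_funM => //; exact: measurable_dot.
Qed.

Let expLE x w : (expR (dot ((N * s) *: z x) w) =
  expR (c * dot w w / 2) * L (s *: w) x)%R.
Proof.
rewrite /L -expRD; congr expR; rewrite !dotZl !dotZr -Ns2 (dotC w (z x)); ring.
Qed.

Let iL nu : P.-integrable setT (EFin \o L nu).
Proof.
apply/integrableP; split; first exact/measurable_EFinP.
under eq_integral do rewrite /= ger0_norm ?expR_ge0//.
by rewrite L1 ltry.
Qed.

Lemma integrable_risk nu :
  P.-integrable setT (fun x => ((h x - dot nu (u x)) * L nu x)%:E).
Proof.
pose C := ((1 + K + K / (2 * 1)) * expR (1 * dot nu nu / 2))%R.
apply: (@le_integrable _ _ _ _ _ _ _ (fun x => C%:E * (L nu x)%:E)) => //.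
- apply/measurable_EFinP; apply: measurable_funM => //.
  by apply: measurable_funB => //; exact: measurable_dot.
- move=> x _; rewrite -EFinM lee_fin !(normrM _ (L nu x)) ler_wpM2r//.
  have bd := affine_le_exp nu ltr01 (hK x) (uK x).
  by rewrite (le_trans bd)// ler_norm.
- by apply: integrableZl => //; exact: iL.
Qed.

Let iphi : (P \x std_gaussian R k).-integrable setT (EFin \o phi).
Proof.
case/andP: c01 => c0 c1.
apply/integrable21ltyP; first exact/measurable_EFinP.
(* Since c < 1 there is room for a rate e > 0 with c + e < 1. *)
pose e := ((1 - c) / 2)%R; pose K' := (K + s ^+ 2 * K)%R.
have e0 : (0 < e)%R by rewrite divr_gt0// subr_gt0.
pose C := (1 + K' + K' / (2 * e))%R.
have K0 (x : T) : (0 <= K)%R by rewrite (le_trans (dot_ge0 (u x)))//.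
have bound w x :
    (`|phi (x, w)| <= C * expR ((e + c) * dot w w / 2) * L (s *: w) x)%R.
  have -> : (C * expR ((e + c) * dot w w / 2) * L (s *: w) x =
      expR (c * dot w w / 2) * L (s *: w) x * (C * expR (e * dot w w / 2)))%R.
    by rewrite (mulrDl e) mulrDl expRD; ring.
  rewrite /phi /= normrM ger0_norm ?expR_ge0// expLE ler_wpM2l//.
    by rewrite mulr_ge0 ?expR_ge0.
  apply: affine_le_exp => //.
  - by rewrite (le_trans (hK x))// lerDl mulr_ge0// ?sqr_ge0// (K0 x).
  - rewrite dotZl dotZr mulrA -expr2 /K' (@le_trans _ _ (s ^+ 2 * K)%R)//.
      by rewrite ler_wpM2l ?sqr_ge0.
    by rewrite lerDr (K0 x).
apply: (@le_lt_trans _ _ (\int[std_gaussian R k]_w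
    (C%:E * (expR ((e + c) * dot w w / 2))%:E))).
  apply: ge0_le_integral => //.
  - by move=> w _; exact: integral_ge0.
  - apply: (measurable_fun_fubini_tonelli_G (fun xw => `|(phi xw)%:E|)) => //.
    by apply: measurableT_comp => //; exact/measurable_EFinP.
  - apply: emeasurable_funM => //; apply/measurable_EFinP.
    exact: measurable_exp_sqr.
  move=> w _.
  apply: (@le_trans _ _ (\int[P]_x
      ((C * expR ((e + c) * dot w w / 2))%:E * (L (s *: w) x)%:E))).
    apply: ge0_le_integral => //.
    + apply: measurableT_comp => //; apply/measurable_EFinP.
      exact: (measurableT_comp mphi).
    + by apply: emeasurable_funM => //; exact/measurable_EFinP.
    + by move=> x _; rewrite -EFinM lee_fin; exact: bound.
  by rewrite integralZl// ?L1 ?mule1 ?EFinM//; exact: iL.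
have ec : (0 <= e + c < 1)%R by rewrite /e addrC half_gap.
rewrite integralZl//; last exact: integrable_exp_sqr.
have := integrable_fin_num measurableT (integrable_exp_sqr ec).
by move: (\int[_]_x _) => [r|//|//] _; rewrite -EFinM ltry.
Qed.

Let phi_psi x : \int[std_gaussian R k]_w (phi (x, w))%:E = (psi x)%:E.
Proof.
apply: etrans (integral_std_exp_affine (h x) ((N * s) *: z x) (s *: u x)) _.
have E1 : (dot ((N * s) *: z x) ((N * s) *: z x) = N * c * dot (z x) (z x))%R.
  by rewrite dotZl dotZr -Ns2 mulrA; congr (_ * _)%R; rewrite !mulrA (mulrAC N s N).
have E2 : (dot ((N * s) *: z x) (s *: u x) = c * dot (z x) (u x))%R.
  by rewrite dotZl dotZr mulrA Ns2.
by rewrite E1 E2.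
Qed.

Lemma integrable_posterior : P.-integrable setT (EFin \o psi).
Proof.
rewrite (_ : EFin \o psi = fubini_F (std_gaussian R k) (EFin \o phi)).
  exact: integrable_fubini_F.
by apply/funext => x; rewrite /fubini_F /= phi_psi.
Qed.

(** Integrated over the sample first, phi is a positive multiple of a difference
    of risks, hence nonpositive; integrated over the prior first, it is psi. *)
Lemma integral_posterior_le0 : \int[P]_x (psi x)%:E <= 0.
Proof.
under eq_integral do rewrite -phi_psi.
rewrite (@Fubini _ _ _ _ _ P (std_gaussian R k) (EFin \o phi) iphi).
rewrite [X in X <= _]integralE (eq_integral (cst 0)); last first.
  move=> w wT; apply: (@le0_funeposE _ _ setT) => // {wT} {}w _.
  have phiE x : (phi (x, w))%:E =
      (expR (c * dot w w / 2))%:E * ((h x - dot (s *: w) (u x)) * L (s *: w) x)%:E.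
    rewrite -EFinM; congr EFin; rewrite /phi/= expLE.
    have -> : dot w (s *: u x) = dot (s *: w) (u x) by rewrite dotZr dotZl.
    by rewrite -mulrA; congr (_ * _)%R; exact: mulrC.
  rewrite (eq_integral _ _ (fun x _ => phiE x)).
  rewrite integralZl//; last exact: integrable_risk.
  by apply: mule_ge0_le0; rewrite ?lee_fin ?expR_ge0.
by rewrite integral0 sub0e oppe_le0; apply: integral_ge0 => w _; exact: funeneg_ge0.
Qed.

End posterior.

(** * Projection on a ball *)

Section projection.
Context (R : realType) (k : nat) (r : R).
Hypothesis r0 : 0 < r.
Implicit Types (x y : 'cV[R]_k).

Lemma normr_dot_le x y : `|dot x y| <= enorm x * enorm y.
Proof.
rewrite ler_norml dot_le_enorm andbT lerNl -dotNl.
by rewrite (le_trans (dot_le_enorm _ _))// /enorm; under eq_bigr do rewrite mxE sqrrN.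
Qed.

Lemma enormZ (c : R) x : 0 <= c -> enorm (c *: x) = c * enorm x.
Proof.
move=> c0; apply/eqP; rewrite -(@eqrXn2 _ 2)//; last 2 first.
- exact: enorm_ge0.
- by rewrite mulr_ge0// enorm_ge0.
by rewrite exprMn !sqr_enorm dotZl dotZr mulrA.
Qed.

Lemma mulmx_bounded l (M : 'M[R]_(l, k)) :
  exists2 C, 0 <= C & forall x, dot (M *m x) (M *m x) <= C * dot x x.
Proof.
exists (\sum_(i < l) dot (row i M)^T (row i M)^T).
  by apply: sumr_ge0 => i _; exact: dot_ge0.
move=> x; rewrite dotE mulr_suml; apply: ler_sum => i _.
have -> : (M *m x) i ord0 = dot (row i M)^T x.
  by rewrite /dot trmxK -row_mul [RHS]mxE.
rewrite -expr2 -!sqr_enorm -exprMn -real_normK ?num_real//.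
by rewrite ler_pXn2r// ?nnegrE ?mulr_ge0 ?enorm_ge0// normr_dot_le.
Qed.

Definition proj y := (r / Num.max r (enorm y)) *: y.

Let max_gt0 y : 0 < Num.max r (enorm y).
Proof. by rewrite lt_max r0. Qed.

Let fac_ge0 y : 0 <= r / Num.max r (enorm y).
Proof. by rewrite divr_ge0// ltW. Qed.

Lemma enorm_proj y : enorm (proj y) <= r.
Proof.
rewrite enormZ// -[leRHS]mulr1 -mulrA ler_pM2l// mulrC ler_pdivrMr//.
by rewrite mul1r le_max lexx orbT.
Qed.

Lemma proj_ge y : r <= enorm y -> proj y = (r / enorm y) *: y.
Proof. by move=> ry; rewrite /proj max_r. Qed.

(** Variational characterization of the projection on a convex set. *)
Lemma proj_var y x : enorm x <= r -> 0 <= dot (proj y - y) (x - proj y).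
Proof.
move=> xr; have [yr|/ltW yr] := leP (enorm y) r.
  by rewrite /proj max_l// divff ?gt_eqF// scale1r subrr dot0l.
have y0 : 0 < enorm y by exact: lt_le_trans yr.
rewrite proj_ge// -[X in _ *: y - X]scale1r -scalerBl dotZl dotBr dotZr.
rewrite -sqr_enorm expr2 mulrA divfK ?gt_eqF// -mulrNN mulr_ge0//.
  by rewrite opprB subr_ge0 ler_pdivrMr// mul1r.
rewrite opprB subr_ge0 (le_trans (dot_le_enorm _ _))// mulrC.
by rewrite ler_wpM2r ?enorm_ge0.
Qed.

Lemma costE x y : cost x y = dot x x / 2 - dot y x.
Proof. by rewrite /cost sqr_enorm mulrC. Qed.

(** The cost is strongly convex, so the excess over its minimum controls the
    distance to the minimizer; in particular the minimizer is unique. *)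
Lemma cost_proj x y : enorm x <= r ->
  dot (x - proj y) (x - proj y) / 2 <= cost x y - cost (proj y) y.
Proof.
move=> /(proj_var y); rewrite !costE !(dotBl, dotBr).
by rewrite (dotC x (proj y)) => h; lra.
Qed.

Lemma argmin_proj y x : argmin_cost (ball_set r) y x -> x = proj y.
Proof.
move=> [xr /(_ _ (enorm_proj y)) h]; have := cost_proj y xr.
have d0 := dot_ge0 (x - proj y) => h'.
by apply/subr0_eq/dot_eq0; lra.
Qed.

(** Shrinking y towards 0 moves it along the ray through its projection. *)
Lemma proj_scale (c : R) y : 0 < c <= 1 -> r <= c * enorm y ->
  proj (c *: y) = proj y.
Proof.
move=> /andP[c0 c1] rcy; have ry : r <= enorm y.
  by rewrite (le_trans rcy)// ler_piMl// enorm_ge0.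
have y0 : 0 < enorm y by exact: lt_le_trans ry.
have rcE : r <= enorm (c *: y) by rewrite enormZ// ltW.
rewrite (proj_ge ry) (proj_ge rcE) enormZ ?(ltW c0)//.
by rewrite scalerA; congr (_ *: _); field; rewrite !gt_eqF.
Qed.

(** When c |y| >= r the projection of y minimizes the cost given c y. Otherwise
    |y| <= 2 r because c >= 1/2, and replacing y by c y changes the difference of
    costs by at most (1 - c) |y| (|x| + r) <= (1 - c) 4 r^2. *)
Lemma cost_shrunk_proj (c : R) x y : 1 / 2 <= c < 1 -> enorm x <= r ->
  dot (x - proj y) (x - proj y) / 2 -
    (if enorm y <= 2 * r then (1 - c) * (4 * r ^+ 2) else 0) <=
  cost x (c *: y) - cost (proj y) (c *: y).
Proof.
move=> /andP[c12 c1] xr; have c0 : 0 < c by lra.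
have q0 : 0 <= (1 - c) * (4 * r ^+ 2).
  by rewrite mulr_ge0 ?subr_ge0 ?(ltW c1)// mulr_ge0// sqr_ge0.
have [rcy|/ltW cyr] := leP r (c * enorm y).
  have c01 : 0 < c <= 1 by rewrite c0 ltW.
  rewrite -(proj_scale c01 rcy); apply: le_trans (cost_proj _ xr).
  by rewrite gerBl; case: ifP.
have y2 : enorm y <= 2 * r by have := enorm_ge0 y; nra.
have hp : - dot y x <= 2 * r * r.
  rewrite (le_trans (ler_norm _))// normrN (le_trans (normr_dot_le _ _))//.
  by rewrite ler_pM ?enorm_ge0.
have hq : dot y (proj y) <= 2 * r * r.
  by rewrite (le_trans (dot_le_enorm _ _))// ler_pM ?enorm_ge0// enorm_proj.
have H : dot y (proj y) - dot y x <= 4 * r ^+ 2 by rewrite expr2; lra.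
have H' : (1 - c) * (dot y (proj y) - dot y x) <= (1 - c) * (4 * r ^+ 2).
  by rewrite ler_wpM2l// subr_ge0 ltW.
rewrite y2; have := cost_proj y xr; rewrite !costE !dotZl => hs.
by lra.
Qed.

Lemma measurable_enorm : measurable_fun setT (@enorm R k).
Proof.
rewrite (_ : @enorm R k = Num.sqrt \o (fun x => dot x x)).
  apply: measurableT_comp; last exact: measurable_dot.
  by apply: continuous_measurable_fun; exact: sqrt_continuous.
apply/funext => x /=; rewrite /enorm dotE.
by under eq_bigr do rewrite expr2.
Qed.

Lemma measurable_proj : measurable_fun setT proj.
Proof.
apply: (@measurable_scalecV _ _ _ _ (fun y => r / Num.max r (enorm y))) => //.
apply: measurable_funM => //.
rewrite (_ : (fun y => _) = (@powR R ^~ (-1)) \o (fun y => Num.max r (enorm y))).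
  apply: measurableT_comp => //.
  by apply: measurable_maxr => //; exact: measurable_enorm.
by apply/funext => y /=; rewrite powR_inv1// ltW.
Qed.

End projection.

(** * Admissibility *)

Lemma integrable_bounded d (T : measurableType d) (R : realType)
    (P : probability T R) (f : T -> R) (C : R) :
  measurable_fun setT f -> (forall x, `|f x| <= C) ->
  P.-integrable setT (EFin \o f).
Proof.
move=> mf fC; apply: (@le_integrable _ _ _ _ _ _ _ (EFin \o cst C)) => //.
- exact/measurable_EFinP.
- by move=> x _; rewrite lee_fin (le_trans (fC x))// ler_norm.
- exact: finite_measure_integrable_cst.
Qed.

Lemma le_vanishing (R : realType) (a C : R) : 0 < C ->
  (forall c, 1 / 2 <= c < 1 -> a <= (1 - c) * C) -> a <= 0.
Proof.
move=> C0 aC; rewrite leNgt; apply/negP => a0.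
pose m := Num.min (1 / 2) (a / (2 * C)).
have m0 : 0 < m by rewrite lt_min; apply/andP; split; rewrite divr_gt0// mulr_gt0.
have m2 : m <= 1 / 2 by rewrite ge_min lexx.
have mC : m * C <= a / 2.
  have -> : a / 2 = a / (2 * C) * C by field; rewrite gt_eqF.
  by rewrite ler_pM2r// ge_min lexx orbT.
have := aC (1 - m); rewrite subKr => /(_ _)/le_trans/(_ mC) h.
suff : a <= a / 2 by lra.
by apply: h; apply/andP; split; lra.
Qed.

Section main.
Context (R : realType) (d n : nat) (n0 : (0 < n)%N) (r : R) (r0 : 0 < r).
Context (S : 'M[R]_d) (symS : S^T = S) (pdS : posdefmx S).
Notation A := (cov_factor S).
Notation P0 := (sample_law n S 0).
Notation N := (n%:R : R).
Notation Omega := (n.-tuple 'cV[R]_d).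

Let sa (xi : Omega) := proj r (sample_mean xi).

Let msa : measurable_fun setT sa.
Proof. exact: (measurableT_comp (@measurable_proj R d r r0) (@measurable_sample_mean R d n)). Qed.

Let Au : A \in unitmx.
Proof. exact: unitmx_factor pdS (cov_factorP symS pdS). Qed.

(** The minimal cost cancels in the comparison of two rules. *)
Lemma loss_cost (mu x y : 'cV[R]_d) :
  loss (ball_set r) mu x - loss (ball_set r) mu y = cost x mu - cost y mu.
Proof. by rewrite /loss; ring. Qed.

Section rule.
Context (del : Omega -> 'cV[R]_d) (mdel : measurable_fun setT del).
Context (del_ball : forall xi, enorm (del xi) <= r).

Lemma measurable_loss (mu : 'cV[R]_d) :
  measurable_fun setT (fun xi => loss (ball_set r) mu (del xi)).
Proof.
apply: measurable_funB => //; under eq_fun do rewrite costE.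
apply: measurable_funB; last exact: measurable_dot.
by apply: measurable_funM => //; exact: measurable_dot.
Qed.

Lemma integrable_loss (nu mu : 'cV[R]_d) : (sample_law n S nu).-integrable setT
  (fun xi => (loss (ball_set r) mu (del xi))%:E).
Proof.
apply: (@integrable_bounded _ _ _ _ _
  (r ^+ 2 / 2 + enorm mu * r + `|inf [set cost z mu | z in ball_set r]|)).
  exact: measurable_loss.
move=> xi; rewrite /loss (le_trans (ler_normB _ _))// lerD2r costE.
rewrite (le_trans (ler_normB _ _))// lerD//.
  by rewrite ger0_norm ?divr_ge0 ?dot_ge0// ler_pM2r// -enorm_le// ltW.
by rewrite (le_trans (normr_dot_le _ _))// ler_wpM2l ?enorm_ge0.
Qed.

Lemma riskE (nu : 'cV[R]_d) : (risk S (ball_set r) (A *m nu) del =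
  \int[P0]_xi ((loss (ball_set r) (A *m nu) (del xi))%:E *
    (expR (N * dot nu (whitened_mean S xi) - N * dot nu nu / 2))%:E))%E.
Proof.
rewrite /risk unlock (sample_density symS pdS n0)//.
by apply/measurable_EFinP; exact: measurable_loss.
Qed.

End rule.

Section agree.
Context (del : Omega -> 'cV[R]_d) (mdel : measurable_fun setT del).
Context (del_ball : forall xi, enorm (del xi) <= r).

Let v xi := del xi - sa xi.
(* The difference of the costs for mu = A nu is h - nu.u, see cost_h. *)
Let h xi := cost (del xi) 0 - cost (sa xi) 0.
Let u xi := A^T *m v xi.

Let mv : measurable_fun setT v.
Proof. exact: measurable_subcV. Qed.

Let mfu : measurable_fun setT u.
Proof. exact: measurable_mulcV. Qed.

Let mh : measurable_fun setT h.
Proof.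
rewrite /h; under eq_fun do rewrite !costE !dot0l !subr0.
by apply: measurable_funB; apply: measurable_funM => //; exact: measurable_dot.
Qed.

Let cost_h nu xi :
  cost (del xi) (A *m nu) - cost (sa xi) (A *m nu) = h xi - dot nu (u xi).
Proof.
rewrite /h /u -dot_mulmx !costE dotBr !dot0l; ring.
Qed.

Let sa_ball xi : enorm (sa xi) <= r.
Proof. exact: enorm_proj. Qed.

Let dd_le (x : 'cV[R]_d) : enorm x <= r -> dot x x <= r ^+ 2.
Proof. by rewrite enorm_le// ltW. Qed.

Let vv_le xi : dot (v xi) (v xi) <= 4 * r ^+ 2.
Proof.
have := dd_le (del_ball xi); have := dd_le (sa_ball xi).
have := dot_ge0 (del xi + sa xi); rewrite /v.
rewrite dotBl !dotBr dotDl !dotDr (dotC (sa xi) (del xi)) => p q s; lra.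
Qed.

Let bounds : exists K, forall xi, `|h xi| <= K /\ dot (u xi) (u xi) <= K.
Proof.
have [C C0 CA] := mulmx_bounded A^T.
exists (r ^+ 2 + C * (4 * r ^+ 2)) => xi; split.
  have := dd_le (del_ball xi); have := dd_le (sa_ball xi).
  have := dot_ge0 (del xi); have := dot_ge0 (sa xi).
  rewrite /h !costE !dot0l => a b e f.
  apply: (@le_trans _ _ (r ^+ 2)); last by rewrite lerDl mulr_ge0// mulr_ge0// sqr_ge0.
  by rewrite ler_norml; apply/andP; split; lra.
rewrite (le_trans (CA _))// (@le_trans _ _ (C * (4 * r ^+ 2)))//.
  by rewrite ler_wpM2l.
by rewrite lerDr sqr_ge0.
Qed.

Hypothesis risk_le : forall mu,
  (risk S (ball_set r) mu del <= risk S (ball_set r) mu sa)%E.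

(** The limit c -> 1 of the inequality averaged over the prior. *)
Lemma mean_sqr_dist_le0 : (\int[P0]_xi (dot (v xi) (v xi) / 2)%:E <= 0)%E.
Proof.
have [K hu] := bounds.
have hK xi := (hu xi).1; have uK xi := (hu xi).2.
have L1 nu : (\int[P0]_xi (expR (N * dot nu (whitened_mean S xi) - N * dot nu nu / 2))%:E = 1)%E.
  have := sample_density symS pdS n0 nu (measurable_cst (1 : \bar R)%E).
  rewrite integral_cst// mul1e [X in X = _]probability_setT => ->.
  by apply: eq_integral => xi _; rewrite mul1e.
have D0 nu : (\int[P0]_xi ((h xi - dot nu (u xi)) *
    expR (N * dot nu (whitened_mean S xi) - N * dot nu nu / 2))%:E <= 0)%E.
  have : (\int[sample_law n S (A *m nu)]_xi (h xi - dot nu (u xi))%:E <= 0)%E.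
    have := risk_le (A *m nu); rewrite /risk unlock.
    rewrite -sube_le0 -integralB_EFin//; last 2 first.
    - exact: integrable_loss.
    - exact: integrable_loss.
    by under eq_integral do rewrite -EFinB loss_cost cost_h.
  rewrite (sample_density symS pdS n0)//.
  apply/measurable_EFinP; apply: measurable_funB => //; exact: measurable_dot.
have N0 : 0 < N by rewrite ltr0n.
have mz := @measurable_whitened_mean R d S n.
have [Ci Ci0 CiA] := mulmx_bounded (invmx A).
(* A bound of exp (n c |z|^2 / 2), uniform in c <= 1, when the sample mean
   has norm at most 2 r. *)
pose B := expR (N * (Ci * (2 * r) ^+ 2) / 2).
have mvv : measurable_fun setT (fun xi => dot (v xi) (v xi) / 2).
  by apply: measurable_funM => //; exact: measurable_dot.
have ivv : P0.-integrable setT (EFin \o (fun xi => dot (v xi) (v xi) / 2)).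
  apply: (@integrable_bounded _ _ _ _ _ (2 * r ^+ 2)) => // xi.
  rewrite ger0_norm ?divr_ge0 ?dot_ge0//; have := vv_le xi; lra.
have fin : (\int[P0]_xi (dot (v xi) (v xi) / 2)%:E)%E \is a fin_num.
  exact: integrable_fin_num ivv.
rewrite -(fineK fin) lee_fin.
apply: (@le_vanishing _ _ (4 * r ^+ 2 * B)).
  by rewrite !mulr_gt0// ?expR_gt0// exprn_gt0.
move=> c /andP[c12 c1].
have c01 : 0 < c < 1 by lra.
have post := integral_posterior_le0 mz mfu mh N0 hK uK c01 L1 D0.
have ipost := integrable_posterior mz mfu mh N0 hK uK c01 L1.
rewrite -subr_le0 -lee_fin EFinB fineK//.
set C := (1 - c) * (4 * r ^+ 2 * B).
have -> : C%:E = (\int[P0]_xi (cst C%:E xi))%E.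
  by rewrite integral_cst// [X in (_ * X)%E]probability_setT mule1.
have iC : P0.-integrable setT (EFin \o cst C) by exact: finite_measure_integrable_cst.
rewrite -integralB_EFin//; apply: le_trans post.
apply: le_integral => //; first exact: integrableB.
move=> xi _; rewrite -EFinB lee_fin /=.
have zE : A *m whitened_mean S xi = sample_mean xi by rewrite /whitened_mean mulKVmx.
have -> : h xi - c * dot (whitened_mean S xi) (u xi) =
    cost (del xi) (c *: sample_mean xi) - cost (sa xi) (c *: sample_mean xi).
  rewrite -zE scalemxAr cost_h; congr (_ - _).
  by rewrite dotZl.
have := cost_shrunk_proj r0 (sample_mean xi) (_ : 1 / 2 <= c < 1) (del_ball xi).
rewrite c12 c1 => /(_ isT).
rewrite -/(sa xi) -/(v xi).
(* E is at least 1, which preserves the quadratic term, and at most B wherever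
   the error term is present. *)
set E := expR _; set q := cost _ _ - _ => hq.
have E1 : 1 <= E.
  by rewrite -expR0 ler_expR divr_ge0// mulr_ge0 ?dot_ge0// mulr_ge0// ltW//; lra.
have q0 : 0 <= (1 - c) * (4 * r ^+ 2).
  by rewrite mulr_ge0 ?subr_ge0 ?(ltW c1)// mulr_ge0// sqr_ge0.
have vE : dot (v xi) (v xi) / 2 <= E * (dot (v xi) (v xi) / 2).
  by rewrite ler_peMl// divr_ge0// dot_ge0.
have C0 : 0 <= C by rewrite /C mulrA mulr_ge0// expR_ge0.
have := ler_wpM2l (le_trans ler01 E1) hq; rewrite mulrBr => /(le_trans _); apply.
apply: lerB => //; case: ifP => [m2|_]; last by rewrite mulr0.
have -> : C = (1 - c) * (4 * r ^+ 2) * B by rewrite /C mulrA.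
rewrite mulrC ler_wpM2l// ler_expR ler_pM2r//.
rewrite -mulrA ler_pM2l// (@le_trans _ _ (dot (whitened_mean S xi) (whitened_mean S xi)))//.
  by rewrite ler_piMl ?dot_ge0// ltW.
by rewrite (le_trans (CiA _))// ler_wpM2l// -enorm_le// mulr_ge0// ltW.
Qed.

(** All laws of the family have a density with respect to P0, so that almost sure
    equality under P0 is almost sure equality under each of them. *)
Lemma same_risk mu :
  risk S (ball_set r) mu del = risk S (ball_set r) mu sa.
Proof.
have -> : mu = A *m (invmx A *m mu) by rewrite mulKVmx.
rewrite !riskE//.
have mvv : measurable_fun setT (fun xi => (dot (v xi) (v xi) / 2)%:E).
  apply/measurable_EFinP; apply: measurable_funM => //; exact: measurable_dot.
have mL nu : measurable_fun setT (fun xi : Omega =>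
    (expR (N * dot nu (whitened_mean S xi) - N * dot nu nu / 2))%:E).
  have mE : measurable_fun setT
      (fun xi : Omega => N * dot nu (whitened_mean S xi) - N * dot nu nu / 2).
    apply: measurable_funB => //; apply: measurable_funM => //.
    exact: (measurable_dot (measurable_cst nu) (@measurable_whitened_mean R d S n)).
  apply/measurable_EFinP; exact: (measurableT_comp (@measurable_expR R) mE).
apply: ae_eq_integral => //.
- apply: emeasurable_funM => //; apply/measurable_EFinP; exact: measurable_loss.
- apply: emeasurable_funM => //; apply/measurable_EFinP; exact: measurable_loss.
have : ae_eq P0 setT (fun xi => (dot (v xi) (v xi) / 2)%:E) (cst 0%E).
  apply/ae_eq_integral_abs => //.
  under eq_integral do rewrite gee0_abs ?lee_fin ?divr_ge0 ?dot_ge0//.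
  apply/eqP; rewrite eq_le mean_sqr_dist_le0/=; apply: integral_ge0 => xi _.
  by rewrite lee_fin divr_ge0 ?dot_ge0.
apply: filterS => xi /= /(_ I) [] vv _.
have /dot_eq0 v0 : dot (v xi) (v xi) = 0 by lra.
by rewrite (subr0_eq v0).
Qed.

End agree.
End main.

Theorem theorem1p3 (R : realType) (d n : nat) (hd : (0 < d)%N) (hn : (0 < n)%N)
    (r : R) (hr : 0 < r) (Sigma : 'M[R]_d)
    (hsym : Sigma^T = Sigma) (hpd : posdefmx Sigma)
    (delta_SA : n.-tuple 'cV[R]_d -> 'cV[R]_d)
    (hSA : forall xi : n.-tuple 'cV[R]_d,
      argmin_cost (ball_set r) (sample_mean xi) (delta_SA xi)) :
  admissible Sigma (ball_set r) delta_SA.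
Proof.
have -> : delta_SA = fun xi => proj r (sample_mean xi).
  by apply/funext => xi; exact: argmin_proj.
move=> [del [mdel delX _] [risk_le [mu]]].
by rewrite (same_risk hn hr hsym hpd mdel delX risk_le) ltxx.
Qed.
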